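(* The map $\Lambda:\mathcal{P}\to\Pi$, $(P,Q)\mapsto\Lambda(P,Q)$, descends to a bijection $$\Lambda:\overline{\mathcal{P}}/\langle\sigma,-\rangle\longrightarrow\overline{\Pi}/\xi,$$ where $\sigma$ and $-$ are the involutions on pairs $\sigma:(P,Q)\mapsto(Q,P)$ and $-:(P,Q)\mapsto(-P,-Q)$. Moreover, $\Lambda$ preserves discriminant and primitivity.
   Context: A binary quadratic form $[a,b,c]$ ($a,b,c\in\mathbb{Z}$) is identified with the symmetric matrix $\begin{pmatrix}2a&b\\ b&2c\end{pmatrix}$; its discriminant is $b^2-4ac$; all forms are assumed non-degenerate ($b^2-4ac\neq0$), but not necessarily definite or primitive. The form is primitive if $\gcd(a,b,c)=1$. $-[a,b,c]=[-a,-b,-c]$. Two forms $[a,b,c],[a',b',c']$ are coprime if $\gcd(a,b,c,a',b',c')=1$. $\mathcal{P}$ is the set of ordered pairs $(P,Q)$ of coprime binary quadratic forms of the same discriminant. $\overline{\mathcal{P}}$ is the set of coprime pairs $(\bar P,\bar Q)$ of $GL(2,\mathbb{Z})$-equivalence classes of forms of the same discriminant, where $g\in GL(2,\mathbb{Z})$ acts by $P\mapsto g^tPg$ and the two entries are transformed independently. The discriminant of a pair is the common discriminant; a pair is primitive if both forms are primitive. $\Gamma^e$ is the lattice of $2\times2$ integer matrices with the symmetric bilinear form determined by $\langle X,X\rangle=2\det X$. $\Pi$ is the set of rank 2 sublattices $M\subset\Gamma^e$ such that $\Gamma^e/M$ is torsion free and the restricted form is non-degenerate; $\perp$ is orthogonal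 complement in $\Gamma^e$. An anti-isometry is an automorphism $\xi$ of the abelian group $\Gamma^e$ with $\langle\xi(x),\xi(x)\rangle=-\langle x,x\rangle$; fix one. The group generated by $O(\Gamma^e)$ and $\xi$ acts on $\Pi$, with $f\in O(\Gamma^e)$ acting by $M\mapsto fM$ and $\xi$ acting by $M\mapsto M^\xi:=\xi(M)^\perp$. $\overline{\Pi}=\Pi/O(\Gamma^e)$, and $\overline{\Pi}/\xi$ is the orbit space of $\Pi$ under this group (independent of the choice of $\xi$). For $X=\begin{pmatrix}\alpha&\beta\\ \gamma&\delta\end{pmatrix}$, $X^A=\begin{pmatrix}\delta&-\beta\\-\gamma&\alpha\end{pmatrix}$ and $X^t$ is the transpose. $\Lambda(P,Q)=\{X\in\Gamma^e\mid X^tP=QX^A\}$. The discriminant of a rank 2 lattice is minus the determinant of its Gram matrix. An even lattice $X$ is primitive as an abstract lattice if $m=1$ is the only positive integer such that $\frac1m\langle\cdot,\cdot\rangle$ is still an even integral form on $X$. Preserving discriminant and primitivity means that an object and its image have the same discriminant and that the object is primitive if and only if its image is (as an abstract lattice). *)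

(* Defs.v *)
From mathcomp Require Import all_boot all_order all_algebra.
From mathcomp Require Import all_classical.
From Stdlib Require Import Relation_Operators.

Set Implicit Arguments.
Unset Strict Implicit.
Unset Printing Implicit Defensive.

Import Order.TTheory GRing.Theory Num.Theory.
Local Open Scope classical_set_scope.
Local Open Scope ring_scope.

(* Let G be a set of self-maps of T that restrict to permutations of S.  Two
   points of S lie in the same orbit of the group generated by G iff one is
   reached from the other by finitely many applications of maps in G and of
   their inverses on S. *)
Definition same_orbit (T : Type) (S : set T) (G : set (T -> T)) : T -> T -> Prop :=
  clos_refl_sym_trans T
    (fun x y => [/\ S x, S y & exists2 g, G g & y = g x]).

Definition group_orbit (T : Type) (S : set T) (G : set (T -> T)) (x : T) : set T :=
  [set y | same_orbit S G x y].

Definition group_orbits (T : Type) (S : set T) (G : set (T -> T)) : set (set T) :=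
  [set group_orbit S G x | x in S].

(* Arbitrary forms [a, b, c]; non-degeneracy is imposed in [form_pairs]. *)
Record bqf : Type := Bqf { qa : int; qb : int; qc : int }.

Definition bqf_mx (P : bqf) : 'M[int]_2 :=
  \matrix_(i < 2, j < 2)
    nth 0 (nth [::] [:: [:: 2 * qa P; qb P]; [:: qb P; 2 * qc P]] i) j.

Definition bqf_disc (P : bqf) : int := qb P ^+ 2 - 4 * qa P * qc P.

Definition bqf_opp (P : bqf) : bqf := Bqf (- qa P) (- qb P) (- qc P).

Definition bqf_content (P : bqf) : int := gcdz (gcdz (qa P) (qb P)) (qc P).

Definition bqf_primitive (P : bqf) : Prop := bqf_content P = 1.

Definition bqf_coprime (P Q : bqf) : Prop :=
  gcdz (bqf_content P) (bqf_content Q) = 1.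

Definition bqf_equiv (P Q : bqf) : Prop :=
  exists2 g : 'M[int]_2, g \in unitmx & bqf_mx Q = g^T *m bqf_mx P *m g.

Definition bqf_class (P : bqf) : set bqf := [set Q | bqf_equiv P Q].

Definition form_pairs : set (bqf * bqf) :=
  [set p | [/\ bqf_disc p.1 != 0, bqf_disc p.1 = bqf_disc p.2
             & bqf_coprime p.1 p.2]].

Definition pair_disc (p : bqf * bqf) : int := bqf_disc p.1.

Definition pair_primitive (p : bqf * bqf) : Prop :=
  bqf_primitive p.1 /\ bqf_primitive p.2.

Definition pair_class (p : bqf * bqf) : set bqf * set bqf :=
  (bqf_class p.1, bqf_class p.2).

(* Discriminant and content are constant on classes, so a coprime pair of
   classes of the same discriminant is the pair of classes of some element of
   [form_pairs]. *)
Definition class_pairs : set (set bqf * set bqf) :=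
  [set pair_class p | p in form_pairs].

Definition class_swap (c : set bqf * set bqf) : set bqf * set bqf := (c.2, c.1).

Definition class_opp (c : set bqf * set bqf) : set bqf * set bqf :=
  (bqf_opp @` c.1, bqf_opp @` c.2).

Definition class_gens : set ((set bqf * set bqf) -> (set bqf * set bqf)) :=
  [set g | g = class_swap \/ g = class_opp].

Notation Gammae := 'M[int]_2.

(* Polarization of X |-> 2 det X. *)
Definition gform (X Y : Gammae) : int := \det (X + Y) - \det X - \det Y.

Definition is_isometry (f : {additive Gammae -> Gammae}) : Prop :=
  bijective f /\ forall X Y, gform (f X) (f Y) = gform X Y.

Definition is_anti_isometry (xi : {additive Gammae -> Gammae}) : Prop :=
  bijective xi /\ forall X, gform (xi X) (xi X) = - gform X X.

Definition perp (M : set Gammae) : set Gammae :=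
  [set X | forall Y, M Y -> gform X Y = 0].

Definition rank2_basis (M : set Gammae) (B : 'I_2 -> Gammae) : Prop :=
  (forall c : 'I_2 -> int, \sum_i c i *: B i = 0 -> forall i, c i = 0) /\
  M = [set \sum_i c i *: B i | c in [set: 'I_2 -> int]].

Definition rank2_lattices : set (set Gammae) :=
  [set M | [/\ exists B, rank2_basis M B,
      (forall (n : int) (X : Gammae), n != 0 -> M (n *: X) -> M X)
    & forall X, M X -> (forall Y, M Y -> gform X Y = 0) -> X = 0]].

Definition isometry_act (f : {additive Gammae -> Gammae}) (M : set Gammae) :
  set Gammae := f @` M.

Definition anti_act (xi : {additive Gammae -> Gammae}) (M : set Gammae) :
  set Gammae := perp (xi @` M).

Definition lattice_gens (xi : {additive Gammae -> Gammae}) :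
    set (set Gammae -> set Gammae) :=
  [set isometry_act f | f in is_isometry] `|` [set anti_act xi].

Definition gram (B : 'I_2 -> Gammae) : 'M[int]_2 :=
  \matrix_(i < 2, j < 2) gform (B i) (B j).

Definition has_lattice_disc (M : set Gammae) (d : int) : Prop :=
  (exists B, rank2_basis M B) /\
  (forall B, rank2_basis M B -> - \det (gram B) = d).

Definition lattice_primitive (M : set Gammae) : Prop :=
  forall m : int, 0 < m ->
    (forall X Y, M X -> M Y -> (m %| gform X Y)%Z) ->
    (forall X, M X -> (2 * m %| gform X X)%Z) ->
    m = 1.

(* X^A is the adjugate \adj X. *)
Definition Lambda (p : bqf * bqf) : set Gammae :=
  [set X | X^T *m bqf_mx p.1 = bqf_mx p.2 *m \adj X].

(* Main.v *)
Require Import Defs.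
From HB Require Import structures.
From mathcomp Require Import all_boot all_order all_algebra.
From mathcomp Require Import all_classical.
From mathcomp Require Import ring zify.
From Stdlib Require Import Relation_Operators.

Set Implicit Arguments.
Unset Strict Implicit.
Unset Printing Implicit Defensive.

Import Order.TTheory GRing.Theory Num.Theory.
Local Open Scope classical_set_scope.
Local Open Scope ring_scope.

(** Number the entries of a 2 x 2 matrix as a vector of Z^4. A saturated rank 2
    lattice with basis X, Y is determined, up to the sign of the basis, by its
    Pluecker coordinates p_ij = x_i y_j - x_j y_i, six coprime integers on the
    quadric p12 p34 - p13 p24 + p14 p23 = 0. The change of coordinates
      P = [p34, p23 - p14, p12],  Q = [- p13, - p14 - p23, - p24]
    turns this quadric into the equality of the discriminants of P and Q and the
    coprimality of the p_ij into that of the two forms, while the equations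
    X^T P = Q adj X become V /\ X /\ Y = 0. Hence Lambda is a bijection between
    coprime pairs of the same discriminant, up to a common sign, and rank 2
    lattices ([Lambda_plucker_span], [Lambda_inj], [rank2_lattice_Lambda]). The
    Gram determinant is minus the discriminant of P ([gram_disc]), and the
    determinant form on the lattice composes P and Q, so its content is the
    product of theirs ([Lambda_primitive]).

    It remains to compare group actions. By [similitude_form], isometries and
    anti-isometries are the maps X |-> g X h and X |-> g X^T h, with det g det h
    equal to 1 or -1. The map X |-> g X h changes P and Q by independent
    equivalences and multiplies Q by det g det h ([Lambda_mul]); transposition
    exchanges P and Q up to equivalence ([Lambda_trmx]); the orthogonal
    complement replaces (P, Q) by (P, - Q) ([perp_Lambda]). The complement
    of the image under an anti-isometry thus carries no sign, and the orbits of
    lattices correspond to the orbits of pairs of forms under independent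
    equivalences, exchange and common sign, that is, to the orbits of pairs of
    classes ([class_orbitP], [lattice_orbitP]). *)

(** * 2 x 2 integer matrices and the determinant form *)

Definition mx2 (x y z w : int) : Gammae := \matrix_(i < 2, j < 2)
    nth 0 (nth [::] [:: [:: x; y]; [:: z; w]] i) j.

Lemma ord2P (P : 'I_2 -> Prop) : P 0 -> P 1 -> forall i, P i.
Proof.
move=> P0 P1 [[|[|//]] lt_i]; first by rewrite (_ : Ordinal lt_i = 0) //; apply: val_inj.
by rewrite (_ : Ordinal lt_i = 1) //; apply: val_inj.
Qed.

Lemma mx2_eta (X : Gammae) : X = mx2 (X 0 0) (X 0 1) (X 1 0) (X 1 1).
Proof. by apply/matrixP; apply: ord2P; apply: ord2P; rewrite mxE. Qed.

Lemma mx2P (P : Gammae -> Prop) :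
  (forall x y z w, P (mx2 x y z w)) -> forall X, P X.
Proof. by move=> P2 X; rewrite [X]mx2_eta. Qed.

Lemma mx2_inj x y z w x' y' z' w' :
  mx2 x y z w = mx2 x' y' z' w' -> [/\ x = x', y = y', z = z' & w = w'].
Proof.
move=> eqm; split.
- by have := congr1 (fun A : Gammae => A 0 0) eqm; rewrite !mxE.
- by have := congr1 (fun A : Gammae => A 0 1) eqm; rewrite !mxE.
- by have := congr1 (fun A : Gammae => A 1 0) eqm; rewrite !mxE.
- by have := congr1 (fun A : Gammae => A 1 1) eqm; rewrite !mxE.
Qed.

Lemma mx2D x y z w x' y' z' w' :
  mx2 x y z w + mx2 x' y' z' w' = mx2 (x + x') (y + y') (z + z') (w + w').
Proof. by apply/matrixP; apply: ord2P; apply: ord2P; rewrite !mxE. Qed.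

Lemma mx2N x y z w : - mx2 x y z w = mx2 (- x) (- y) (- z) (- w).
Proof. by apply/matrixP; apply: ord2P; apply: ord2P; rewrite !mxE. Qed.

Lemma mx2Z k x y z w : k *: mx2 x y z w = mx2 (k * x) (k * y) (k * z) (k * w).
Proof. by apply/matrixP; apply: ord2P; apply: ord2P; rewrite !mxE. Qed.

Lemma mx2T x y z w : (mx2 x y z w)^T = mx2 x z y w.
Proof. by apply/matrixP; apply: ord2P; apply: ord2P; rewrite !mxE. Qed.

Lemma mx2M x y z w x' y' z' w' :
  mx2 x y z w *m mx2 x' y' z' w' =
  mx2 (x * x' + y * z') (x * y' + y * w') (z * x' + w * z') (z * y' + w * w').
Proof.
by apply/matrixP; apply: ord2P; apply: ord2P;
  rewrite !mxE !big_ord_recl big_ord0 /= !mxE /= addr0.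
Qed.

Lemma mx2_0 : 0 = mx2 0 0 0 0.
Proof. by apply/matrixP; apply: ord2P; apply: ord2P; rewrite !mxE. Qed.

Lemma det_mx2 x y z w : \det (mx2 x y z w) = x * w - y * z.
Proof.
rewrite (expand_det_row _ 0) !big_ord_recl big_ord0 /cofactor !det_mx11 !mxE /=.
rewrite /bump /=; ring.
Qed.

Lemma adj_mx2 x y z w : \adj (mx2 x y z w) = mx2 w (- y) (- z) x.
Proof.
apply/matrixP; apply: ord2P; apply: ord2P;
  rewrite !mxE /cofactor det_mx11 !mxE /= /bump /=; ring.
Qed.

Definition mx2E := (mx2D, mx2N, mx2Z, mx2T, mx2M, det_mx2, adj_mx2).

Lemma gform_mx2 x y z w x' y' z' w' :
  gform (mx2 x y z w) (mx2 x' y' z' w') = x * w' + x' * w - y * z' - y' * z.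
Proof. rewrite /gform !mx2E; ring. Qed.

Lemma bqf_mxE P : bqf_mx P = mx2 (2 * qa P) (qb P) (qb P) (2 * qc P).
Proof. by []. Qed.

Lemma unitmx_det (g : Gammae) : g \in unitmx -> \det g = 1 \/ \det g = -1.
Proof. by rewrite unitmxE => /orP[] /eqP; [left|right]. Qed.

Lemma unitmx_of_det (g : Gammae) : \det g = 1 \/ \det g = -1 -> g \in unitmx.
Proof. by rewrite unitmxE => -[] ->. Qed.

Lemma big_ord2 (V : nmodType) (F : 'I_2 -> V) : \sum_i F i = F 0 + F 1.
Proof.
rewrite !big_ord_recl big_ord0 addr0; congr (_ + F _); exact: val_inj.
Qed.

Lemma dvdz1_gt0 (m : int) : (m %| 1)%Z -> 0 <= m -> m = 1.
Proof. by rewrite dvdz1 => /eqP; lia. Qed.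

(** * Binary quadratic forms: content, action, discriminant *)

Definition bqf_dvd (m : int) (P : bqf) : bool :=
  [&& (m %| qa P)%Z, (m %| qb P)%Z & (m %| qc P)%Z].

Lemma dvd_content m P : (m %| bqf_content P)%Z = bqf_dvd m P.
Proof. by rewrite /bqf_content !dvdz_gcd /bqf_dvd andbA. Qed.

Lemma bqf_primitiveP P :
  bqf_primitive P <-> forall m, bqf_dvd m P -> (m %| 1)%Z.
Proof.
split=> [P1 m | P1]; first by rewrite -dvd_content P1.
by apply: dvdz1_gt0 => //; apply: P1; rewrite -dvd_content.
Qed.

Lemma bqf_coprimeP P Q :
  bqf_coprime P Q <-> forall m, bqf_dvd m P -> bqf_dvd m Q -> (m %| 1)%Z.
Proof.
split=> [PQ1 m mP mQ | PQ1].
  have: (m %| gcdz (bqf_content P) (bqf_content Q))%Z.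
    by rewrite dvdz_gcd !dvd_content mP.
  by rewrite PQ1.
by apply: dvdz1_gt0 => //; apply: PQ1; rewrite -dvd_content ?dvdz_gcdl ?dvdz_gcdr.
Qed.

Lemma bqf_content_Bezout P :
  exists u v w, u * qa P + v * qb P + w * qc P = bqf_content P.
Proof.
have [u1 [v1 e1]] := Bezoutz (qa P) (qb P).
have [u2 [v2 e2]] := Bezoutz (gcdz (qa P) (qb P)) (qc P).
exists (u2 * u1), (u2 * v1), v2; rewrite /bqf_content -e2 -e1; ring.
Qed.

Definition bqf_act (g : Gammae) (P : bqf) : bqf :=
  Bqf (qa P * g 0 0 ^+ 2 + qb P * (g 0 0 * g 1 0) + qc P * g 1 0 ^+ 2)
      (2 * qa P * (g 0 0 * g 0 1) + qb P * (g 0 0 * g 1 1 + g 0 1 * g 1 0)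
        + 2 * qc P * (g 1 0 * g 1 1))
      (qa P * g 0 1 ^+ 2 + qb P * (g 0 1 * g 1 1) + qc P * g 1 1 ^+ 2).

Lemma bqf_mx_act g P : bqf_mx (bqf_act g P) = g^T *m bqf_mx P *m g.
Proof.
rewrite [g in RHS]mx2_eta !bqf_mxE !mx2E /=; congr mx2; ring.
Qed.

Lemma bqf_mx_inj : injective bqf_mx.
Proof.
move=> [a b c] [a' b' c']; rewrite !bqf_mxE /= => /mx2_inj [ea -> _ ec].
congr Bqf; lia.
Qed.

Lemma bqf_equivP P Q :
  bqf_equiv P Q <-> exists2 g : Gammae, g \in unitmx & Q = bqf_act g P.
Proof.
split=> -[g ug eQ]; exists g => //; last by rewrite eQ bqf_mx_act.
by apply: bqf_mx_inj; rewrite eQ bqf_mx_act.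
Qed.

Lemma bqf_act1 P : bqf_act 1%:M P = P.
Proof. by apply: bqf_mx_inj; rewrite bqf_mx_act trmx1 mul1mx mulmx1. Qed.

Lemma bqf_actM g h P : bqf_act (g *m h) P = bqf_act h (bqf_act g P).
Proof. by apply: bqf_mx_inj; rewrite !bqf_mx_act trmx_mul !mulmxA. Qed.

Lemma bqf_actK g P : g \in unitmx -> bqf_act (invmx g) (bqf_act g P) = P.
Proof. by move=> ug; rewrite -bqf_actM mulmxV // bqf_act1. Qed.

Lemma bqf_disc_act g P : bqf_disc (bqf_act g P) = \det g ^+ 2 * bqf_disc P.
Proof. rewrite [g in RHS]mx2_eta det_mx2 /bqf_disc /=; ring. Qed.

Lemma bqf_dvd_actW m g P : bqf_dvd m P -> bqf_dvd m (bqf_act g P).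
Proof.
case: P => a b c /and3P[/= ma mb mc].
have mM k l n : (m %| k)%Z -> (m %| l * k * n)%Z.
  by move=> mk; rewrite dvdz_mulr // dvdz_mull.
by apply/and3P; split=> /=; rewrite !rpredD ?mM // dvdz_mulr.
Qed.

Lemma bqf_dvd_act m g P : g \in unitmx -> bqf_dvd m (bqf_act g P) = bqf_dvd m P.
Proof.
move=> ug; apply/idP/idP; last exact: bqf_dvd_actW.
by move/(bqf_dvd_actW (invmx g)); rewrite bqf_actK.
Qed.

Lemma bqf_act_opp g P : bqf_act g (bqf_opp P) = bqf_opp (bqf_act g P).
Proof. rewrite /bqf_act /bqf_opp /=; congr Bqf; ring. Qed.

Lemma bqf_oppK : involutive bqf_opp.
Proof. by case=> a b c; rewrite /bqf_opp /= !opprK. Qed.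

Lemma bqf_dvd_opp m P : bqf_dvd m (bqf_opp P) = bqf_dvd m P.
Proof. by rewrite /bqf_dvd /= !rpredN. Qed.

Lemma bqf_disc_opp P : bqf_disc (bqf_opp P) = bqf_disc P.
Proof. rewrite /bqf_disc /=; ring. Qed.

(** * Pluecker coordinates *)

(** Number the entries of a matrix row by row. A bivector with coordinates p_ij
    in the second exterior power of Z^4 splits into its self-dual and its
    anti-self-dual part for the determinant form; these are the two forms. *)
Definition plucker_pair (p12 p13 p14 p23 p24 p34 : int) : bqf * bqf :=
  (Bqf p34 (p23 - p14) p12, Bqf (- p13) (- p14 - p23) (- p24)).

Definition plucker (X Y : Gammae) : bqf * bqf :=
  plucker_pair (X 0 0 * Y 0 1 - X 0 1 * Y 0 0)
               (X 0 0 * Y 1 0 - X 1 0 * Y 0 0)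
               (X 0 0 * Y 1 1 - X 1 1 * Y 0 0)
               (X 0 1 * Y 1 0 - X 1 0 * Y 0 1)
               (X 0 1 * Y 1 1 - X 1 1 * Y 0 1)
               (X 1 0 * Y 1 1 - X 1 1 * Y 1 0).

Lemma plucker_mx2 x y z w x' y' z' w' :
  plucker (mx2 x y z w) (mx2 x' y' z' w') =
  plucker_pair (x * y' - y * x') (x * z' - z * x') (x * w' - w * x')
               (y * z' - z * y') (y * w' - w * y') (z * w' - w * z').
Proof. by rewrite /plucker !mxE. Qed.

(** The four equations say that the exterior product of the matrix with the
    bivector p vanishes. *)
Lemma Lambda_plucker_pair p12 p13 p14 p23 p24 p34 x y z w :
  Lambda (plucker_pair p12 p13 p14 p23 p24 p34) (mx2 x y z w) <->
  [/\ x * p23 - y * p13 + z * p12 = 0, x * p24 - y * p14 + w * p12 = 0,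
      x * p34 - z * p14 + w * p13 = 0 & y * p34 - z * p24 + w * p23 = 0].
Proof.
rewrite /Lambda /= !bqf_mxE !mx2E /=; split=> [/mx2_inj[e1 e2 e3 e4]|[e1 e2 e3 e4]].
  by split; lia.
congr mx2; lia.
Qed.

(** The difference of the two discriminants is four times the Pluecker
    quadric. *)
Lemma disc_plucker_pair p12 p13 p14 p23 p24 p34 :
  let p := plucker_pair p12 p13 p14 p23 p24 p34 in
  bqf_disc p.1 = bqf_disc p.2 <-> p12 * p34 - p13 * p24 + p14 * p23 = 0.
Proof. by rewrite /bqf_disc /=; split=> H; lia. Qed.

(** The outer coefficients are coordinates up to sign; the half sum and the half
    difference of the middle coefficients are integral because a common
    discriminant makes them congruent modulo 2. *)
Lemma plucker_pair_of_disc p : bqf_disc p.1 = bqf_disc p.2 ->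
  exists p12 p13 p14 p23 p24 p34,
    p = plucker_pair p12 p13 p14 p23 p24 p34 /\
    p12 * p34 - p13 * p24 + p14 * p23 = 0.
Proof.
case: p => [[a b c] [a' b' c']] eD.
suff [s [r [eb eb']]] : exists s r, b = r - s /\ b' = - s - r.
  exists c, (- a'), s, r, (- c'), a; move: eD.
  have -> : (Bqf a b c, Bqf a' b' c') = plucker_pair c (- a') s r (- c') a.
    by rewrite /plucker_pair eb eb' !opprK.
  by move/disc_plucker_pair.
have [k ek] : exists k, b = 2 * k \/ b = 2 * k + 1 by exists (b %/ 2)%Z; lia.
have [l el] : exists l, b' = 2 * l \/ b' = 2 * l + 1 by exists (b' %/ 2)%Z; lia.
exists ((- b - b') %/ 2)%Z, ((b - b') %/ 2)%Z; move: eD; rewrite /bqf_disc /=.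
by case: ek el => -> [] -> eD; split; lia.
Qed.

(** If the first row (p12, p13, p14) is g times a primitive vector y, one basis
    vector can be taken to be (0, y) and the other (g, x). The Pluecker relation
    says that the remaining coordinates form a vector orthogonal to y, hence a
    cross product x * y, and Bezout coefficients of y give x explicitly. *)
Lemma bivector_decomp_row p12 p13 p14 p23 p24 p34 :
  p12 * p34 - p13 * p24 + p14 * p23 = 0 ->
  [|| p12 != 0, p13 != 0 | p14 != 0] ->
  exists x1 x2 x3 x4 y1 y2 y3 y4 : int,
  [/\ [/\ p12 = x1 * y2 - x2 * y1, p13 = x1 * y3 - x3 * y1 &
          p14 = x1 * y4 - x4 * y1],
      p23 = x2 * y3 - x3 * y2, p24 = x2 * y4 - x4 * y2
    & p34 = x3 * y4 - x4 * y3].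
Proof.
move=> rel nz.
set g := bqf_content (Bqf p12 p13 p14).
have [e2 [e3 [e4 /= eg]]] := bqf_content_Bezout (Bqf p12 p13 p14).
have: bqf_dvd g (Bqf p12 p13 p14) by rewrite -dvd_content.
case/and3P=> /= /dvdzP[y2 h2] /dvdzP[y3 h3] /dvdzP[y4 h4].
have g0 : g != 0.
  by apply: contraTneq nz => g0; rewrite h2 h3 h4 g0 !mulr0 eqxx.
have ey : e2 * y2 + e3 * y3 + e4 * y4 = 1.
  apply: (mulfI g0); rewrite mulr1 -[RHS]eg h2 h3 h4; ring.
have rel' : y2 * p34 - y3 * p24 + y4 * p23 = 0.
  apply: (mulfI g0); rewrite mulr0 -[RHS]rel h2 h3 h4; ring.
exists g, (p23 * e3 + p24 * e4), (p34 * e4 - p23 * e2), (- p24 * e2 - p34 * e3).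
exists 0, y2, y3, y4; split; first by split; lia.
- transitivity (p23 * (e2 * y2 + e3 * y3 + e4 * y4)); first by rewrite ey mulr1.
  apply/eqP; rewrite -subr_eq0 -[X in X == _](_ : e4 * (y2 * p34 - y3 * p24 + y4 * p23) = _).
    by rewrite rel' mulr0.
  ring.
- transitivity (p24 * (e2 * y2 + e3 * y3 + e4 * y4)); first by rewrite ey mulr1.
  apply/eqP; rewrite -subr_eq0 -[X in X == _](_ : - e3 * (y2 * p34 - y3 * p24 + y4 * p23) = _).
    by rewrite rel' mulr0.
  ring.
- transitivity (p34 * (e2 * y2 + e3 * y3 + e4 * y4)); first by rewrite ey mulr1.
  apply/eqP; rewrite -subr_eq0 -[X in X == _](_ : e2 * (y2 * p34 - y3 * p24 + y4 * p23) = _).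
    by rewrite rel' mulr0.
  ring.
Qed.

(** If the first row of the bivector vanishes, the discriminant is p23 ^ 2, so
    the second row does not; exchanging the first two coordinates brings it to
    the first place. *)
Lemma form_pairs_plucker p : form_pairs p -> exists X Y, p = plucker X Y.
Proof.
case=> D0 eD _.
have [p12 [p13 [p14 [p23 [p24 [p34 [ep rel]]]]]]] := plucker_pair_of_disc eD.
have [nz|] := boolP [|| p12 != 0, p13 != 0 | p14 != 0].
  have [x1 [x2 [x3 [x4 [y1 [y2 [y3 [y4 [[e1 e2 e3] e4 e5 e6]]]]]]]]] :=
    bivector_decomp_row rel nz.
  exists (mx2 x1 x2 x3 x4), (mx2 y1 y2 y3 y4).
  by rewrite ep plucker_mx2 e1 e2 e3 e4 e5 e6.
rewrite !negb_or !negbK => /and3P[/eqP z12 /eqP z13 /eqP z14].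
have nz : [|| - p12 != 0, p23 != 0 | p24 != 0].
  apply: contraNT D0; rewrite !negb_or !negbK => /and3P[_ /eqP z23 _].
  by rewrite ep /bqf_disc /= z12 z14 z23; apply/eqP; ring.
have rel' : (- p12) * p34 - p23 * p14 + p24 * p13 = 0 by lia.
have [x1 [x2 [x3 [x4 [y1 [y2 [y3 [y4 [[e1 e2 e3] e4 e5 e6]]]]]]]]] :=
  bivector_decomp_row rel' nz.
(* Undo the exchange of the first two coordinates. *)
exists (mx2 x2 x1 x3 x4), (mx2 y2 y1 y3 y4).
by rewrite ep plucker_mx2 e2 e3 e4 e5 e6 -[p12]opprK e1 opprB.
Qed.

Definition span2 (X Y : Gammae) : set Gammae :=
  [set V | exists a b : int, V = a *: X + b *: Y].

Lemma bqf_coprime_Bezout P Q : bqf_coprime P Q -> exists u1 u2 u3 v1 v2 v3,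
  u1 * qa P + u2 * qb P + u3 * qc P + (v1 * qa Q + v2 * qb Q + v3 * qc Q) = 1.
Proof.
move=> PQ1; have [u1 [u2 [u3 eu]]] := bqf_content_Bezout P.
have [v1 [v2 [v3 ev]]] := bqf_content_Bezout Q.
have [s [t est]] := Bezoutz (bqf_content P) (bqf_content Q).
exists (s * u1), (s * u2), (s * u3), (t * v1), (t * v2), (t * v3).
rewrite -[RHS]PQ1 -est -eu -ev; ring.
Qed.

(** A vector V of Lambda satisfies V /\ X /\ Y = 0. Cramer's rule then writes
    p_ij V as an integral combination of X and Y for each i and j, and a Bezout
    combination of these identities writes V itself so. *)
Lemma Lambda_plucker_span X Y :
  bqf_coprime (plucker X Y).1 (plucker X Y).2 ->
  Lambda (plucker X Y) = span2 X Y.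
Proof.
elim/mx2P: X => x1 x2 x3 x4; elim/mx2P: Y => y1 y2 y3 y4.
rewrite plucker_mx2 => /bqf_coprime_Bezout [u1 [u2 [u3 [v1 [v2 [v3 /= bez]]]]]].
apply/seteqP; split=> V; last first.
  by case=> a [b ->]; rewrite !mx2E; apply/Lambda_plucker_pair; split; ring.
elim/mx2P: V => w1 w2 w3 w4 /Lambda_plucker_pair[e1 e2 e3 e4].
(* The Bezout relation of the forms, rewritten in the coordinates p_ij. *)
pose c12 := u3; pose c13 := - v1; pose c14 := - u2 - v2.
pose c23 := u2 - v2; pose c24 := - v3; pose c34 := u1.
have {}bez : c12 * (x1 * y2 - x2 * y1) + c13 * (x1 * y3 - x3 * y1)
    + c14 * (x1 * y4 - x4 * y1) + c23 * (x2 * y3 - x3 * y2)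
    + c24 * (x2 * y4 - x4 * y2) + c34 * (x3 * y4 - x4 * y3) = 1.
  by rewrite -[RHS]bez /c12 /c13 /c14 /c23 /c24 /c34; ring.
exists (c12 * (w1 * y2 - w2 * y1) + c13 * (w1 * y3 - w3 * y1)
    + c14 * (w1 * y4 - w4 * y1) + c23 * (w2 * y3 - w3 * y2)
    + c24 * (w2 * y4 - w4 * y2) + c34 * (w3 * y4 - w4 * y3)).
exists (c12 * (x1 * w2 - x2 * w1) + c13 * (x1 * w3 - x3 * w1)
    + c14 * (x1 * w4 - x4 * w1) + c23 * (x2 * w3 - x3 * w2)
    + c24 * (x2 * w4 - x4 * w2) + c34 * (x3 * w4 - x4 * w3)).
rewrite !mx2E; clearbody c12 c13 c14 c23 c24 c34.
(* In coordinate k, the terms with k in {i, j} agree identically; the others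
   agree by the equations of Lambda. *)
congr mx2.
- have := congr1 ( *%R c23) e1; have := congr1 ( *%R c24) e2.
  have := congr1 ( *%R c34) e3; have := congr1 ( *%R w1) bez.
  clear; lia.
- have := congr1 ( *%R c13) e1; have := congr1 ( *%R c14) e2.
  have := congr1 ( *%R c34) e4; have := congr1 ( *%R w2) bez.
  clear; lia.
- have := congr1 ( *%R c12) e1; have := congr1 ( *%R c14) e3.
  have := congr1 ( *%R c24) e4; have := congr1 ( *%R w3) bez.
  clear; lia.
- have := congr1 ( *%R c12) e2; have := congr1 ( *%R c13) e3.
  have := congr1 ( *%R c23) e4; have := congr1 ( *%R w4) bez.
  clear; lia.
Qed.

(** * The lattices of Lambda are the rank 2 lattices *)

Definition pair_map (f : bqf -> bqf) (p : bqf * bqf) : bqf * bqf := (f p.1, f p.2).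

Definition bqf_scale (k : int) (P : bqf) : bqf := Bqf (k * qa P) (k * qb P) (k * qc P).

Lemma rank2_basisP M B : rank2_basis M B <->
  (forall a b : int, a *: B 0 + b *: B 1 = 0 -> a = 0 /\ b = 0) /\
  M = span2 (B 0) (B 1).
Proof.
have pick2 (a b : int) : exists2 c : 'I_2 -> int, c 0 = a & c 1 = b.
  by exists (fun i => if i == 0 then a else b).
have span2E : [set \sum_i c i *: B i | c in [set: 'I_2 -> int]] = span2 (B 0) (B 1).
  apply/seteqP; split=> V.
    by case=> c _ <-; exists (c 0), (c 1); rewrite big_ord2.
  case=> a [b ->]; have [c c0 c1] := pick2 a b.
  by exists c => //; rewrite big_ord2 c0 c1.
rewrite /rank2_basis span2E; split=> -[ind ->]; split=> //.
  move=> a b; have [c <- <-] := pick2 a b => eq0.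
  by split; apply: ind; rewrite big_ord2.
by move=> c; rewrite big_ord2 => /ind[c0 c1]; apply: ord2P.
Qed.

(** The factor is the determinant of the change of basis. *)
Lemma plucker_span2 X Y X' Y' : span2 X Y X' -> span2 X Y Y' ->
  exists k, plucker X' Y' = pair_map (bqf_scale k) (plucker X Y).
Proof.
elim/mx2P: X => x1 x2 x3 x4; elim/mx2P: Y => y1 y2 y3 y4.
case=> a [b ->] [c [d ->]]; exists (a * d - b * c).
rewrite !mx2E !plucker_mx2 /pair_map /bqf_scale /plucker_pair /=.
congr (Bqf _ _ _, Bqf _ _ _); ring.
Qed.

Lemma bqf_scale1 P : bqf_scale 1 P = P.
Proof. by case: P => a b c; rewrite /bqf_scale /= !mul1r. Qed.

Lemma bqf_scaleN1 P : bqf_scale (-1) P = bqf_opp P.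
Proof. by rewrite /bqf_scale !mulN1r. Qed.

Lemma bqf_disc_scale k P : bqf_disc (bqf_scale k P) = k ^+ 2 * bqf_disc P.
Proof. rewrite /bqf_disc /=; ring. Qed.

Lemma bqf_dvd_scale k P : bqf_dvd k (bqf_scale k P).
Proof. by rewrite /bqf_dvd /= !dvdz_mulr. Qed.

Lemma dvdz1P (k : int) : (k %| 1)%Z -> k = 1 \/ k = -1.
Proof. by rewrite dvdz1; lia. Qed.

Lemma Lambda_span p : form_pairs p ->
  exists X Y, p = plucker X Y /\ Lambda p = span2 X Y.
Proof.
move=> fp; have [X [Y ep]] := form_pairs_plucker fp; exists X, Y; split=> //.
by case: fp => _ _; rewrite ep => /Lambda_plucker_span.
Qed.

Lemma span2l X Y : span2 X Y X.
Proof. by exists 1, 0; rewrite scale1r scale0r addr0. Qed.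

Lemma span2r X Y : span2 X Y Y.
Proof. by exists 0, 1; rewrite scale1r scale0r add0r. Qed.

(** Two bases of one lattice have proportional Pluecker coordinates, and
    coprimality forces the factor to be a sign. *)
Lemma Lambda_inj p q : form_pairs p -> form_pairs q -> Lambda p = Lambda q ->
  q = p \/ q = pair_map bqf_opp p.
Proof.
move=> fp fq epq; have [X [Y [ep sp]]] := Lambda_span fp.
have [X' [Y' [eq sq]]] := Lambda_span fq.
have [||k] := @plucker_span2 X Y X' Y'.
- by rewrite -sp epq sq; exact: span2l.
- by rewrite -sp epq sq; exact: span2r.
rewrite -ep -eq => eqk; have: (k %| 1)%Z.
  case: fq => _ _ /bqf_coprimeP; apply; rewrite eqk; exact: bqf_dvd_scale.
by case/dvdz1P=> ek; [left|right];
  rewrite eqk ek /pair_map ?bqf_scale1 ?bqf_scaleN1; case: (p).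
Qed.

Lemma plucker_indep X Y : bqf_disc (plucker X Y).1 != 0 ->
  forall a b : int, a *: X + b *: Y = 0 -> a = 0 /\ b = 0.
Proof.
elim/mx2P: X => x1 x2 x3 x4; elim/mx2P: Y => y1 y2 y3 y4.
rewrite plucker_mx2 /bqf_disc /= => D0 a b; rewrite !mx2E mx2_0.
case/mx2_inj=> e1 e2 e3 e4.
set D := (X in X != 0) in D0.
have killp xi xj yi yj : a * xi + b * yi = 0 -> a * xj + b * yj = 0 ->
   a * (xi * yj - xj * yi) = 0 /\ b * (xi * yj - xj * yi) = 0.
  move=> ei ej; split.
    have := congr1 ( *%R yj) ei; have := congr1 ( *%R yi) ej; clear; lia.
  have := congr1 ( *%R xj) ei; have := congr1 ( *%R xi) ej; clear; lia.
have [a12 b12] := killp _ _ _ _ e1 e2.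
have [a23 b23] := killp _ _ _ _ e2 e3.
have [a14 b14] := killp _ _ _ _ e1 e4.
have killD c : c * (x1 * y2 - x2 * y1) = 0 -> c * (x2 * y3 - x3 * y2) = 0 ->
    c * (x1 * y4 - x4 * y1) = 0 -> c = 0.
  move=> c12 c23 c14; apply/eqP; rewrite -(mulIr_eq0 _ (mulIf D0)); apply/eqP.
  transitivity ((x2 * y3 - x3 * y2 - (x1 * y4 - x4 * y1)) *
      (c * (x2 * y3 - x3 * y2) - c * (x1 * y4 - x4 * y1))
    - 4 * (x3 * y4 - x4 * y3) * (c * (x1 * y2 - x2 * y1))); first by rewrite /D; ring.
  by rewrite c12 c23 c14 subrr !mulr0.
by split; apply: killD.
Qed.

Lemma gformE X Y : gform X Y = X 0 0 * Y 1 1 + Y 0 0 * X 1 1 - X 0 1 * Y 1 0 - Y 0 1 * X 1 0.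
Proof.
by elim/mx2P: X => x y z w; elim/mx2P: Y => x' y' z' w'; rewrite gform_mx2 !mxE.
Qed.

Lemma gformDZl a b X Y V : gform (a *: X + b *: Y) V = a * gform X V + b * gform Y V.
Proof. rewrite !gformE !mxE; ring. Qed.

Lemma gformC X Y : gform X Y = gform Y X.
Proof. rewrite !gformE; ring. Qed.

Lemma gform_diag X : gform X X = 2 * \det X.
Proof. elim/mx2P: X => x y z w; rewrite gform_mx2 det_mx2; ring. Qed.

(** In terms of Z = adj X * Y, both sides are the discriminant of the
    characteristic polynomial of Z; the first form is the traceless part of Z
    read as a quadratic form. *)
Lemma gram_disc X Y :
  gform X Y ^+ 2 - gform X X * gform Y Y = bqf_disc (plucker X Y).1.
Proof. rewrite !gformE /bqf_disc /=; ring. Qed.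

Lemma Lambda_rank2 p : form_pairs p -> rank2_lattices (Lambda p).
Proof.
move=> fp; have [X [Y [ep sp]]] := Lambda_span fp.
have D0 : bqf_disc (plucker X Y).1 != 0 by case: fp; rewrite ep.
split.
- exists (fun i => if i == 0 then X else Y); apply/rank2_basisP; split=> //=.
  exact: plucker_indep.
- move=> n V n0; rewrite /Lambda /= adjZ expr1 linearZ /= -scalemxAl -scalemxAr => eqn.
  by apply/matrixP => i j; have /matrixP/(_ i j) := eqn; rewrite !mxE => /(mulfI n0).
- rewrite sp => V [a [b ->]] orth.
  have := orth X (span2l X Y); have := orth Y (span2r X Y).
  rewrite !gformDZl (gformC Y X) => eY eX.
  suff [-> ->] : a = 0 /\ b = 0 by rewrite !scale0r addr0.
  move: D0; rewrite -gram_disc => D0.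
  split; apply/eqP; rewrite -(mulIr_eq0 _ (mulIf D0)); apply/eqP.
    have := congr1 ( *%R (gform X Y)) eY; have := congr1 ( *%R (gform Y Y)) eX.
    clear; lia.
  have := congr1 ( *%R (gform X X)) eY; have := congr1 ( *%R (gform X Y)) eX.
  clear; lia.
Qed.

Lemma Lambda_disc p : form_pairs p -> has_lattice_disc (Lambda p) (pair_disc p).
Proof.
move=> fp; split; first by have [] := Lambda_rank2 fp.
move=> B /rank2_basisP[_ eB].
have [X [Y [ep sp]]] := Lambda_span fp.
have -> : - \det (gram B) = bqf_disc (plucker (B 0) (B 1)).1.
  rewrite -gram_disc [gram B]mx2_eta det_mx2 !mxE (gformC (B 1) (B 0)); ring.
have [||k ek] := @plucker_span2 X Y (B 0) (B 1).
- by rewrite -sp eB; exact: span2l.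
- by rewrite -sp eB; exact: span2r.
have [||l el] := @plucker_span2 (B 0) (B 1) X Y.
- by rewrite -eB sp; exact: span2l.
- by rewrite -eB sp; exact: span2r.
have /dvdz1P[k1|k1] : (k %| 1)%Z.
  case: fp => _ _ /bqf_coprimeP; apply; rewrite ep el ek;
  by apply/and3P; split; apply: dvdz_mull; apply: dvdz_mulr; exact: dvdzz.
- by rewrite ek bqf_disc_scale k1 expr1n mul1r /pair_disc ep.
- by rewrite ek bqf_disc_scale k1 sqrrN expr1n mul1r /pair_disc ep.
Qed.

(** Away from 2, p14 and p23 are recovered from their sum and difference. At 2,
    if the other coordinates and the difference p23 - p14 are even, then p14 and
    p23 have the same parity and the Pluecker relation makes their product
    even, so both are even. *)
Lemma plucker_pair_coprime p12 p13 p14 p23 p24 p34 :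
  let p := plucker_pair p12 p13 p14 p23 p24 p34 in
  p12 * p34 - p13 * p24 + p14 * p23 = 0 ->
  (forall m, [&& m %| p12, m %| p13, m %| p14, m %| p23, m %| p24 & m %| p34]%Z ->
     (m %| 1)%Z) ->
  bqf_coprime p.1 p.2.
Proof.
move=> p rel prim; apply/bqf_coprimeP => m /and3P[/= m34 mb m12] /and3P[/=].
rewrite !rpredN => m13 mb' m24.
have [m2|m2] := boolP (2 %| m)%Z.
  suff: (2 %| 1)%Z by [].
  move: (dvdz_trans m2 m34) (dvdz_trans m2 mb) (dvdz_trans m2 m12).
  move: (dvdz_trans m2 m13) (dvdz_trans m2 m24).
  move=> d13 d24 d34 db d12; apply: prim; rewrite d12 d13 d24 d34 /=.
  case/dvdzP: d12 => k12 e12; case/dvdzP: d13 => k13 e13; case/dvdzP: db => k eb.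
  have e14 : (2 %| p14 * p23)%Z.
    apply/dvdzP; exists (k13 * p24 - k12 * p34).
    by move: rel; rewrite e12 e13; clear; lia.
  have d14 : (2 %| p14)%Z.
    have [j ej] : exists j, p14 = 2 * j \/ p14 = 2 * j + 1.
      by clear; exists (p14 %/ 2)%Z; lia.
    case: ej => ej; first by rewrite ej dvdz_mulr.
    move: e14; rewrite (_ : p23 = k * 2 + p14); last by rewrite -eb subrK.
    case/dvdzP=> l; rewrite ej; clear; lia.
  rewrite d14 /= (_ : p23 = k * 2 + p14); last by rewrite -eb subrK.
  by rewrite rpredD // dvdz_mull.
have cop : coprimez m 2.
  by rewrite coprimez_sym coprimezE prime_coprime // -dvdzE.
apply: prim; rewrite m12 m13 m24 m34 /= andbT.
rewrite -(Gauss_dvdzr p14 cop) -(Gauss_dvdzr p23 cop); apply/andP; split.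
  have -> : 2 * p14 = - (p23 - p14) - (- p14 - p23) by ring.
  by apply: rpredB => //; rewrite rpredN.
have -> : 2 * p23 = (p23 - p14) - (- p14 - p23) by ring.
exact: rpredB.
Qed.

(** If m divides all the Pluecker coordinates, it divides each vector
    y_i X - x_i Y; saturation then makes m divide the coefficients x_i and y_i,
    hence X itself, which is primitive. *)
Lemma saturated_plucker_coprime X Y :
  (forall a b : int, a *: X + b *: Y = 0 -> a = 0 /\ b = 0) ->
  (forall (n : int) V, n != 0 -> span2 X Y (n *: V) -> span2 X Y V) ->
  bqf_coprime (plucker X Y).1 (plucker X Y).2.
Proof.
elim/mx2P: X => x1 x2 x3 x4; elim/mx2P: Y => y1 y2 y3 y4; rewrite plucker_mx2.
set X := mx2 _ _ _ _; set Y := mx2 _ _ _ _ => ind sat.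
apply: plucker_pair_coprime; first by ring.
move=> m /and5P[m12 m13 m14 m23 /andP[m24 m34]].
have ind2 (a b c d : int) : a *: X + b *: Y = c *: X + d *: Y -> a = c /\ b = d.
  move/eqP; rewrite -subr_eq0 opprD addrACA -!scalerBl => /eqP/ind[].
  by move=> /eqP + /eqP; rewrite !subr_eq0 => /eqP -> /eqP ->.
(* The case m = 0 is allowed: it stands for vanishing coordinates. *)
have div a b V : a *: X + b *: Y = m *: V -> (m %| a)%Z /\ (m %| b)%Z.
  move=> e; have [m0|m0] := eqVneq m 0.
    by move: e; rewrite m0 scale0r => /ind[-> ->].
  have [|c [d eV]] := sat m V m0; first by exists a, b.
  by move: e; rewrite eV scalerDr !scalerA => /ind2[-> ->]; rewrite !dvdz_mulr.
have [m1 _] : (m %| 1)%Z /\ (m %| 0)%Z; last by [].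
have d14 : [/\ (m %| x1)%Z, (m %| x2)%Z, (m %| x3)%Z & (m %| x4)%Z].
  case/dvdzP: m12 => k12 e12; case/dvdzP: m13 => k13 e13.
  case/dvdzP: m14 => k14 e14; case/dvdzP: m23 => k23 e23.
  case/dvdzP: m24 => k24 e24; case/dvdzP: m34 => k34 e34.
  have [|_] := div y1 (- x1) (mx2 0 (- k12) (- k13) (- k14)).
    by rewrite !mx2E; congr mx2; lia.
  have [|_] := div y2 (- x2) (mx2 k12 0 (- k23) (- k24)).
    by rewrite !mx2E; congr mx2; lia.
  have [|_] := div y3 (- x3) (mx2 k13 k23 0 (- k34)).
    by rewrite !mx2E; congr mx2; lia.
  have [|_] := div y4 (- x4) (mx2 k14 k24 k34 0).
    by rewrite !mx2E; congr mx2; lia.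
  by rewrite !rpredN.
case: d14 => /dvdzP[z1 e1] /dvdzP[z2 e2] /dvdzP[z3 e3] /dvdzP[z4 e4].
apply: (div _ _ (mx2 z1 z2 z3 z4)); rewrite scale1r scale0r addr0.
by rewrite mx2E /X e1 e2 e3 e4; congr mx2; rewrite mulrC.
Qed.

(** Non-degeneracy makes the discriminant nonzero: otherwise the vector
    <X, Y> X - <X, X> Y would be orthogonal to the whole lattice, hence zero, and X as well. *)
Lemma rank2_lattice_Lambda M : rank2_lattices M ->
  exists2 p, form_pairs p & Lambda p = M.
Proof.
case=> -[B /rank2_basisP[]]; move: (B 0) (B 1) => X Y ind -> sat nondeg.
have cop := saturated_plucker_coprime ind sat.
exists (plucker X Y); last exact: Lambda_plucker_span.
split=> //; last by apply/disc_plucker_pair; ring.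
apply/eqP=> D0.
have X0 : X = 0.
  apply: (nondeg X (span2l X Y)) => V [a [b ->]].
  have /ind[/eqP] : gform X Y *: X + (- gform X X) *: Y = 0.
    apply: nondeg; first by exists (gform X Y), (- gform X X).
    move=> W [c [d ->]]; rewrite gformC !gformDZl !(gformC _ (_ + _)) !gformDZl.
    rewrite (gformC Y X).
    transitivity (d * (gform X Y ^+ 2 - gform X X * gform Y Y)); first by ring.
    by rewrite gram_disc D0 mulr0.
  move=> /eqP gXY /eqP; rewrite oppr_eq0 => /eqP gXX.
  by rewrite gformC gformDZl (gformC Y X) gXX gXY !mulr0 addr0.
by have [|] := ind 1 0; first by rewrite X0 scaler0 scale0r addr0.
Qed.

(** * Orthogonal complement, transposition, primitivity *)

(** The rows of the skew-symmetric matrix (p_ij): for a bivector X /\ Y they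
    are the vectors x_i Y - y_i X, which span the lattice when the p_ij are
    coprime. *)
Lemma plucker_rows p12 p13 p14 p23 p24 p34 :
  p12 * p34 - p13 * p24 + p14 * p23 = 0 ->
  let L := Lambda (plucker_pair p12 p13 p14 p23 p24 p34) in
  [/\ L (mx2 0 p12 p13 p14), L (mx2 (- p12) 0 p23 p24),
      L (mx2 (- p13) (- p23) 0 p34) & L (mx2 (- p14) (- p24) (- p34) 0)].
Proof. by move=> rel L; split; apply/Lambda_plucker_pair; split; lia. Qed.

(** Orthogonality to the four rows of (p_ij) is the system defining the lattice
    of (P, -Q): the orthogonal complement is the Hodge star, which is 1 on the
    self-dual part and -1 on the anti-self-dual part. *)
Lemma perp_Lambda p : form_pairs p ->
  perp (Lambda p) = Lambda (p.1, bqf_opp p.2).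
Proof.
case=> D0 eD _; have [p12 [p13 [p14 [p23 [p24 [p34 [ep rel]]]]]]] := plucker_pair_of_disc eD.
have -> : (p.1, bqf_opp p.2) = plucker_pair p12 (- p13) (- p23) (- p14) (- p24) p34.
  rewrite ep /plucker_pair /bqf_opp /=; congr (Bqf _ _ _, Bqf _ _ _); ring.
move: D0; rewrite ep /bqf_disc /= => D0.
have [r1 r2 r3 r4] := plucker_rows rel.
apply/seteqP; split; elim/mx2P=> v1 v2 v3 v4.
  move=> orth; apply/Lambda_plucker_pair.
  move: (orth _ r1) (orth _ r2) (orth _ r3) (orth _ r4); rewrite !gform_mx2.
  by clear; move=> *; split; lia.
case/Lambda_plucker_pair=> f1 f2 f3 f4; elim/mx2P=> y1 y2 y3 y4.
case/Lambda_plucker_pair=> e1 e2 e3 e4; rewrite gform_mx2.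
set G := (X in X = 0); have eG : G = v1 * y4 + y1 * v4 - v2 * y3 - y2 * v3 by [].
have G12 : p12 * G = 0.
  have := congr1 ( *%R y2) f1; have := congr1 ( *%R y1) f2.
  have := congr1 ( *%R v1) e2; have := congr1 ( *%R v2) e1.
  rewrite eG; clear; lia.
have G14 : p14 * G = 0.
  have := congr1 ( *%R y4) f1; have := congr1 ( *%R y1) f4.
  have := congr1 ( *%R v2) e3; have := congr1 ( *%R v3) e2.
  rewrite eG; clear; lia.
have G23 : p23 * G = 0.
  have := congr1 ( *%R y3) f2; have := congr1 ( *%R y2) f3.
  have := congr1 ( *%R v4) e1; have := congr1 ( *%R v1) e4.
  rewrite eG; clear; lia.
apply: (mulfI D0); rewrite mulr0.
transitivity ((p23 - p14) * (p23 * G - p14 * G) - 4 * p34 * (p12 * G)); first by ring.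
by rewrite G12 G14 G23; ring.
Qed.

(** The rotation through which the adjugate and the transpose are conjugate. *)
Definition bqf_rot : Gammae := mx2 0 (-1) 1 0.

(** Transposing the defining equation exchanges the two sides, and conjugating
    by the rotation turns the adjugate of X into the transpose of X. *)
Lemma Lambda_trmx P Q X :
  Lambda (bqf_act bqf_rot Q, bqf_act bqf_rot P) X^T <-> Lambda (P, Q) X.
Proof.
elim/mx2P: X => x y z w; rewrite /Lambda /= !bqf_mxE !mx2E /= !mxE /=.
by split=> /mx2_inj[e1 e2 e3 e4]; congr mx2; lia.
Qed.

Lemma dvdz_mul_coprime (m k : int) P Q : bqf_coprime P Q ->
  bqf_dvd m (bqf_scale k P) -> bqf_dvd m (bqf_scale k Q) -> (m %| k)%Z.
Proof.
case/bqf_coprime_Bezout=> u1 [u2 [u3 [v1 [v2 [v3 bez]]]]].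
move=> /and3P[/= a b c] /and3P[/= a' b' c'].
rewrite (_ : k = u1 * (k * qa P) + u2 * (k * qb P) + u3 * (k * qc P)
  + (v1 * (k * qa Q) + v2 * (k * qb Q) + v3 * (k * qc Q))); first by rewrite !rpredD // dvdz_mull.
rewrite -[LHS]mulr1 -bez; ring.
Qed.

(** Every coefficient of the second form times det X is a combination of
    coefficients of the first form P: for instance a' det X = P(x, z), where a'
    is the leading coefficient of the second form and (x, z) the first column of
    X. As m is prime to the content of the second form, it divides det X. *)
Lemma dvd_det_Lambda m p X : form_pairs p -> bqf_dvd m p.1 -> Lambda p X ->
  (m %| \det X)%Z.
Proof.
case=> _ eD cop; have [p12 [p13 [p14 [p23 [p24 [p34 [ep rel]]]]]]] := plucker_pair_of_disc eD.
move: cop; rewrite ep => cop mP.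
case/and3P: (mP) => /= m34 mb m12; elim/mx2P: X => x y z w.
case/Lambda_plucker_pair=> e1 e2 e3 e4; rewrite det_mx2.
set d := x * w - y * z.
have d23 : (m %| d * p23)%Z.
  have -> : d * p23 = - (z * w * p12 + x * y * p34 + y * z * (p23 - p14)).
    have := congr1 ( *%R w) e1; have := congr1 ( *%R y) e3; rewrite /d; clear; lia.
  by rewrite rpredN !rpredD // dvdz_mull.
apply: (dvdz_mul_coprime cop).
  by apply/and3P; split=> /=; apply: dvdz_mull.
apply/and3P; split=> /=.
- have -> : d * - p13 = x ^+ 2 * p34 + x * z * (p23 - p14) + z ^+ 2 * p12.
    have := congr1 ( *%R z) e1; have := congr1 ( *%R x) e3; rewrite /d; clear; lia.
  by rewrite !rpredD // dvdz_mull.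
- have -> : d * (- p14 - p23) = d * (p23 - p14) - d * p23 *+ 2 by ring.
  by apply: rpredB; [apply: dvdz_mull | apply: rpredMn].
- have -> : d * - p24 = y ^+ 2 * p34 + y * w * (p23 - p14) + w ^+ 2 * p12.
    have := congr1 ( *%R w) e2; have := congr1 ( *%R y) e4; rewrite /d; clear; lia.
  by rewrite !rpredD // dvdz_mull.
Qed.

Lemma bqf_rot_unit : bqf_rot \in unitmx.
Proof. by apply: unitmx_of_det; left; rewrite det_mx2. Qed.

Lemma form_pairs_act g h P Q : g \in unitmx -> h \in unitmx ->
  form_pairs (P, Q) -> form_pairs (bqf_act g P, bqf_act h Q).
Proof.
move=> ug uh [/= D0 eD /bqf_coprimeP cop].
have sq (k : Gammae) : k \in unitmx -> \det k ^+ 2 = 1.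
  by move=> /unitmx_det[] ->.
split=> /=; first by rewrite bqf_disc_act sq // mul1r.
  by rewrite !bqf_disc_act !sq // !mul1r.
by apply/bqf_coprimeP => m; rewrite !bqf_dvd_act //; apply: cop.
Qed.

Lemma form_pairs_swap P Q : form_pairs (P, Q) -> form_pairs (Q, P).
Proof.
move=> [/= D0 eD /bqf_coprimeP cop]; split=> //=; first by rewrite -eD.
by apply/bqf_coprimeP => m mQ mP; apply: cop.
Qed.

Lemma form_pairs_opp p : form_pairs p -> form_pairs (pair_map bqf_opp p).
Proof.
move=> [/= D0 eD /bqf_coprimeP cop]; split=> /=; rewrite ?bqf_disc_opp //.
by apply/bqf_coprimeP => m; rewrite !bqf_dvd_opp; apply: cop.
Qed.

Lemma form_pairs_opp2 P Q : form_pairs (P, Q) -> form_pairs (P, bqf_opp Q).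
Proof.
move=> [/= D0 eD /bqf_coprimeP cop]; split=> /=; rewrite ?bqf_disc_opp //.
by apply/bqf_coprimeP => m; rewrite bqf_dvd_opp; apply: cop.
Qed.

(** The determinant form on Lambda composes P and Q: each product of a coefficient
    of P by a coefficient of Q is, up to sign, a value of it on a row of (p_ij),
    a polar value on two rows, or the sum of two such polar values. A common
    divisor of the values therefore divides the product of the contents. The
    converse is [dvd_det_Lambda], applied to the content of P and, after
    transposition, to that of Q. *)
Lemma Lambda_primitive p : form_pairs p ->
  pair_primitive p <-> lattice_primitive (Lambda p).
Proof.
move=> fp; split; last first.
  move=> primL; have content1 P' :
      (forall X, Lambda p X -> (bqf_content P' %| \det X)%Z) -> bqf_content P' != 0 ->
      bqf_primitive P'.
    move=> dvd_det P0; apply: primL.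
    - by rewrite lt_neqAle eq_sym P0.
    - have LD X Y : Lambda p X -> Lambda p Y -> Lambda p (X + Y).
        rewrite /Lambda /=; elim/mx2P: X => ? ? ? ?; elim/mx2P: Y => ? ? ? ?.
        rewrite !bqf_mxE !mx2E => /mx2_inj[? ? ? ?] /mx2_inj[? ? ? ?].
        by congr mx2; lia.
      by move=> X Y LX LY; apply: rpredB; [apply: rpredB|]; apply: dvd_det => //; apply: LD.
    - by move=> X LX; rewrite gform_diag dvdz_mul2l //; apply: dvd_det.
  have content0 P' : bqf_disc P' != 0 -> bqf_content P' != 0.
    apply: contraNneq => P0; have: bqf_dvd 0 P' by rewrite -dvd_content P0.
    by case/and3P; rewrite !dvd0z /bqf_disc => /eqP-> /eqP-> _; rewrite expr0n mulr0 mul0r.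
  case: (fp) => D0 eD _; split; apply: content1 (content0 _ _) => //.
  - by move=> X; apply: dvd_det_Lambda => //; rewrite -dvd_content.
  - move=> X LX; rewrite -det_tr.
    apply: (@dvd_det_Lambda _ (bqf_act bqf_rot p.2, bqf_act bqf_rot p.1)).
    + by apply: form_pairs_act bqf_rot_unit bqf_rot_unit _; apply: form_pairs_swap; case: (p) fp.
    + by rewrite /= bqf_dvd_act ?bqf_rot_unit // -dvd_content.
    + by apply/Lambda_trmx; case: (p) LX.
  - by rewrite -eD.
case=> P1 Q1 m m0 mL m2L; apply: dvdz1_gt0 (ltW m0).
have {}m2L X : Lambda p X -> (m %| \det X)%Z.
  by move/m2L; rewrite gform_diag dvdz_mul2l.
case: (fp) => D0 eD _.
have [p12 [p13 [p14 [p23 [p24 [p34 [ep rel]]]]]]] := plucker_pair_of_disc eD.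
move: P1 Q1 mL m2L; rewrite ep => P1 Q1 mL m2L.
have [r1 r2 r3 r4] := plucker_rows rel.
have /and3P[/= Qa Qb Qc] : bqf_dvd m (plucker_pair p12 p13 p14 p23 p24 p34).2.
  have [u1 [u2 [u3 /= eu]]] := bqf_content_Bezout (plucker_pair p12 p13 p14 p23 p24 p34).1.
  rewrite P1 in eu.
  have comb q : (m %| p34 * q)%Z -> (m %| (p23 - p14) * q)%Z -> (m %| p12 * q)%Z -> (m %| q)%Z.
    move=> d1 d2 d3; rewrite -[q]mul1r -eu.
    rewrite (_ : _ * q = u1 * (p34 * q) + u2 * ((p23 - p14) * q) + u3 * (p12 * q)); last by ring.
    by rewrite !rpredD // dvdz_mull.
  apply/and3P; split=> /=; apply: comb.
  - by have := m2L _ r3; rewrite det_mx2; congr (_ %| _)%Z; ring.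
  - by have := mL _ _ r1 r3; rewrite gform_mx2 -rpredN; congr (_ %| _)%Z; ring.
  - by have := m2L _ r1; rewrite det_mx2; congr (_ %| _)%Z; ring.
  - by have := mL _ _ r3 r4; rewrite gform_mx2; congr (_ %| _)%Z; ring.
  (* The product of the middle coefficients is p23 ^ 2 - p14 ^ 2 up to sign. *)
  - have := rpredD (mL _ _ r1 r4) (mL _ _ r2 r3); rewrite !gform_mx2 -rpredN.
    by congr (_ %| _)%Z; ring.
  - by have := mL _ _ r1 r2; rewrite gform_mx2; congr (_ %| _)%Z; ring.
  - by have := m2L _ r4; rewrite det_mx2; congr (_ %| _)%Z; ring.
  - by have := mL _ _ r2 r4; rewrite gform_mx2 -rpredN; congr (_ %| _)%Z; ring.
  - by have := m2L _ r2; rewrite det_mx2; congr (_ %| _)%Z; ring.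
by move/bqf_primitiveP: Q1; apply; apply/and3P.
Qed.

(** * Similitudes of the determinant form *)

(** Isometries and anti-isometries are treated together, as the multipliers 1
    and -1. *)
Definition similitude (e : int) (f : {additive Gammae -> Gammae}) : Prop :=
  bijective f /\ forall X Y, gform (f X) (f Y) = e * gform X Y.

Lemma isometryP f : is_isometry f <-> similitude 1 f.
Proof. by split=> -[bf gf]; split=> // X Y; rewrite gf mul1r. Qed.

Lemma gform_polar X Y : 2 * gform X Y = gform (X + Y) (X + Y) - gform X X - gform Y Y.
Proof. rewrite !gformE !mxE; ring. Qed.

Lemma anti_isometry_similitude f : is_anti_isometry f -> similitude (-1) f.
Proof.
case=> bf gf; split=> // X Y.
have two : 2 != 0 :> int by [].
apply: (mulfI two); rewrite mulrCA !gform_polar -raddfD !gf; ring.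
Qed.

(** A hyperbolic frame whose first vector is +-E11. The matrix D has rank 1
    and is not orthogonal to A, so that left and right multiplications fixing
    +-E11 bring it to +-E22. The isotropic vectors orthogonal to both are then
    the multiples of E12 and of E21, and B and C are, in one order or the other,
    these two vectors up to a common scaling by signs. *)
Lemma frame_normal (d e : int) (B C D : Gammae) :
  d = 1 \/ d = -1 -> e = 1 \/ e = -1 -> let A := mx2 d 0 0 0 in
  [/\ gform B B = 0, gform C C = 0 & gform D D = 0] ->
  [/\ gform A B = 0, gform A C = 0, gform D B = 0 & gform D C = 0] ->
  gform A D = e -> gform B C = - e ->
  exists g h : Gammae, [/\ g \in unitmx, h \in unitmx &
    (forall x y z w, x *: A + y *: B + z *: C + w *: D = g *m mx2 x y z w *m h) \/
    (forall x y z w, x *: A + y *: B + z *: C + w *: D = g *m (mx2 x y z w)^T *m h)].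
Proof.
move=> d1 e1 /=.
elim/mx2P: B => p q r v; elim/mx2P: C => p' q' r' v'; elim/mx2P: D => t b c u.
rewrite !gform_mx2 => -[BB CC DD] [AB AC DB DC] AD BC.
have v0 : v = 0 by case: d1 AB => ->; clear; lia.
have v0' : v' = 0 by case: d1 AC => ->; clear; lia.
have eu : u = d * e by case: d1 AD => ->; clear; lia.
have qr : q * r = 0 by move: BB; rewrite v0; clear; lia.
have qr' : q' * r' = 0 by move: CC; rewrite v0'; clear; lia.
have eqr : q * r' + q' * r = e by move: BC; rewrite v0 v0'; clear; lia.
have u1 : u = 1 \/ u = -1 by rewrite eu; case: d1 e1 => -> [] ->; clear; lia.
have et : t = u * b * c by case: u1 DD => ->; clear; lia.
have ep : p = u * (q * c + b * r) by case: u1 DB => ->; rewrite v0; clear; lia.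
have ep' : p' = u * (q' * c + b * r') by case: u1 DC => ->; rewrite v0'; clear; lia.
have unit_pm (k l : int) : k * l = e -> k = 1 \/ k = -1.
  by move=> kl; apply: dvdz1P; case: e1 kl => -> kl; apply/dvdzP;
    [exists l | exists (- l)]; move: kl; clear; lia.
(* Exactly one of q and r vanishes; q = 0 is the transposed case. *)
have [q0|q0] := eqVneq q 0.
  have eqr2 : q' * r = e by rewrite -eqr q0 mul0r add0r.
  have q1 := unit_pm _ _ eqr2.
  have r0' : r' = 0 by case: q1 qr' => ->; clear; lia.
  pose k := q' * d.
  (* The columns of g and the rows of h are read off from the rank 1 matrices
     A and D; the sign k rescales the images of E12 and E21 together. *)
  exists (mx2 d (k * b) 0 (k * u)), (mx2 1 0 (k * u * c) k).
  have k1 : k = 1 \/ k = -1 by rewrite /k; case: d1 q1 => -> [] ->; clear; lia.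
  have er : r = q' * e by case: q1 eqr2 => ->; clear; lia.
  split; try (apply: unitmx_of_det; rewrite det_mx2).
  - by case: d1 u1 k1 => -> [] -> [] ->; clear; lia.
  - by case: k1 => ->; clear; lia.
  right=> x y z w; rewrite !mx2E v0 v0' r0' q0 ep ep' et r0' q0 er eu /k.
  by case: d1 e1 q1 => -> [] -> [] ->; clear; congr mx2; ring.
have r0 : r = 0 by apply: (mulfI q0); rewrite mulr0.
have eqr2 : q * r' = e by rewrite -eqr r0 mulr0 addr0.
have q1 := unit_pm _ _ eqr2.
have q0' : q' = 0.
  have r1 : r' = 1 \/ r' = -1 by apply: (unit_pm _ q); rewrite mulrC.
  by case: r1 qr' => ->; clear; lia.
pose k := q * d.
exists (mx2 d (k * b) 0 (k * u)), (mx2 1 0 (k * u * c) k).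
have k1 : k = 1 \/ k = -1 by rewrite /k; case: d1 q1 => -> [] ->; clear; lia.
have er : r' = q * e by case: q1 eqr2 => ->; clear; lia.
split; try (apply: unitmx_of_det; rewrite det_mx2).
- by case: d1 u1 k1 => -> [] -> [] ->; clear; lia.
- by case: k1 => ->; clear; lia.
left=> x y z w; rewrite !mx2E v0 v0' r0 q0' ep ep' et r0 q0' er eu /k.
by case: d1 e1 q1 => -> [] -> [] ->; clear; congr mx2; ring.
Qed.

Lemma raddf_scale (f : {additive Gammae -> Gammae}) (k : int) X : f (k *: X) = k *: f X.
Proof. by rewrite -[k]intz !scaler_int raddfMz. Qed.

Lemma gform_mul g h X Y :
  gform (g *m X *m h) (g *m Y *m h) = \det g * \det h * gform X Y.
Proof.
rewrite /gform -mulmxDl -mulmxDr !det_mulmx; ring.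
Qed.

(** A singular matrix has Smith form diag(d, 0); for the image of E11 under a
    bijection, d is a unit because E11 is not a proper multiple. *)
Lemma similitude_E11 e f : similitude e f ->
  exists L R d, [/\ L \in unitmx, R \in unitmx, d = 1 \/ d = -1 &
    f (mx2 1 0 0 0) = L *m mx2 d 0 0 0 *m R].
Proof.
case=> [[f' fK f'K] gf]; have [L uL [R uR [s srt eN]]] := int_Smith_normal_form (f (mx2 1 0 0 0)).
have eD : (\matrix_(i, j) (s`_i *+ (i == j :> nat))) = mx2 s`_0 0 0 s`_1 :> Gammae.
  by apply/matrixP; apply: ord2P; apply: ord2P; rewrite !mxE.
rewrite eD in eN.
have s1 : s`_1 = 0.
  have : \det (f (mx2 1 0 0 0)) = 0.
    have two : 2 != 0 :> int by [].
    by apply: (mulfI two); rewrite -gform_diag gf gform_diag det_mx2; ring.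
  rewrite eN !det_mulmx det_mx2 => /eqP.
  have nz (g : Gammae) : g \in unitmx -> \det g != 0 by case/unitmx_det=> ->.
  rewrite !mulf_eq0 (negPf (nz _ uL)) (negPf (nz _ uR)) orbF /= mulr0 subr0.
  rewrite mulf_eq0 => /orP[] /eqP // s0; apply/eqP; rewrite -dvd0z -s0.
  by case: (s) srt => [|a [|b l]] //= /andP[].
exists L, R, s`_0; split=> //; last by rewrite eN s1.
apply: dvdz1P; have: mx2 1 0 0 0 = s`_0 *: f' (L *m mx2 1 0 0 0 *m R).
  apply: (can_inj fK); rewrite raddf_scale f'K eN s1 scalemxAl scalemxAr.
  by rewrite mx2Z mulr1 mulr0.
elim/mx2P: (f' _) => x y z w; rewrite mx2Z => /mx2_inj[e1 _ _ _].
by apply/dvdzP; exists x; rewrite mulrC.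
Qed.

(** The Smith form of the image of E11 reduces the problem, by left and right
    multiplication, to a map that fixes E11 up to sign. *)
Lemma similitude_form e f : e = 1 \/ e = -1 -> similitude e f ->
  exists g h : Gammae, [/\ g \in unitmx, h \in unitmx &
    (forall X, f X = g *m X *m h) \/ (forall X, f X = g *m X^T *m h)].
Proof.
move=> e1 sf; have [L [R [d [uL uR d1 f11]]]] := similitude_E11 sf.
case: sf => _ gf.
pose F X := invmx L *m f X *m invmx R.
have fF X : f X = L *m F X *m R by rewrite /F !mulmxA mulmxKV // mulmxV // mul1mx.
pose e' := \det (invmx L) * \det (invmx R) * e.
have gF X Y : gform (F X) (F Y) = e' * gform X Y by rewrite /F gform_mul gf mulrA.
have e1' : e' = 1 \/ e' = -1.
  have /unitmx_det dL : invmx L \in unitmx by rewrite unitmx_inv.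
  have /unitmx_det dR : invmx R \in unitmx by rewrite unitmx_inv.
  by rewrite /e'; case: dL dR e1 => -> [] -> [] ->; clear; lia.
have F11 : F (mx2 1 0 0 0) = mx2 d 0 0 0.
  by rewrite /F f11 !mulmxA mulVmx // mul1mx mulmxK.
have FZ k X : k *: F X = F (k *: X).
  by rewrite /F raddf_scale -scalemxAr -scalemxAl.
have FD X Y : F X + F Y = F (X + Y) by rewrite /F raddfD mulmxDr mulmxDl.
have eF x y z w : F (mx2 x y z w) = x *: mx2 d 0 0 0 + y *: F (mx2 0 1 0 0)
    + z *: F (mx2 0 0 1 0) + w *: F (mx2 0 0 0 1).
  by rewrite -F11 !FZ !FD !mx2E; congr (F (mx2 _ _ _ _)); ring.
have [||||||g [h [ug uh gh]]] := @frame_normal d e' (F (mx2 0 1 0 0))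
    (F (mx2 0 0 1 0)) (F (mx2 0 0 0 1)); rewrite -?F11 ?gF ?gform_mx2 //.
- by split; ring.
- by split; ring.
- ring.
- ring.
exists (L *m g), (h *m R); rewrite !unitmx_mul uL ug uh uR; split=> //.
by case: gh => gh; [left|right]; elim/mx2P=> x y z w; rewrite fF eF gh !mulmxA.
Qed.

(** * Orbits of pairs of forms and of pairs of classes *)

Lemma same_orbit_map (T U : Type) (S : set T) G (D : set U) H (pi : T -> U) :
  (forall x g, S x -> S (g x) -> G g -> same_orbit D H (pi x) (pi (g x))) ->
  forall x y, same_orbit S G x y -> same_orbit D H (pi x) (pi y).
Proof.
move=> step x y; elim=> {x y} [x y [Sx Sy [g Gg ey]]|x|x y _|x y z _ xy _ yz].
- by rewrite ey in Sy *; apply: step.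
- exact: rst_refl.
- exact: rst_sym.
- exact: rst_trans yz.
Qed.

(** An orbit relation can be computed upstairs along a surjection pi as soon as
    the fibres of pi and the lifts of each generator stay in one orbit. *)
Lemma same_orbit_lift (T U : Type) (S : set T) G (D : set U) H (pi : U -> T) :
  (forall p, D p -> S (pi p)) -> (forall x, S x -> exists2 p, D p & pi p = x) ->
  (forall p q, D p -> D q -> pi p = pi q -> same_orbit D H p q) ->
  (forall p q g, D p -> D q -> G g -> pi q = g (pi p) -> same_orbit D H p q) ->
  forall p q, D p -> D q -> same_orbit S G (pi p) (pi q) -> same_orbit D H p q.
Proof.
move=> piS surj fib step p q Dp Dq pq.
suff /(_ _ _ pq)[_]: forall x y, same_orbit S G x y -> (S x <-> S y) /\
    forall p q, D p -> D q -> pi p = x -> pi q = y -> same_orbit D H p q.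
  exact.
move=> x y; elim=> {x y p q Dp Dq pq} [x y [Sx Sy [g Gg ey]]|x|x y _ [xy IH]
  |x y z _ [xy IH1] _ [yz IH2]].
- split=> // p q Dp Dq ep eq; apply: (step p q g) => //; rewrite eq ep //.
- by split=> // p q Dp Dq ep eq; apply: fib; rewrite // ep eq.
- by split=> [|p q Dp Dq ep eq]; [split=> /xy | apply: rst_sym; apply: IH].
split=> [|p q Dp Dq ep eq]; first by rewrite xy.
have [|r Dr er] := surj y; first by rewrite -xy -ep; exact: piS.
by apply: (rst_trans _ _ _ r); [apply: IH1 | apply: IH2].
Qed.

Definition pair_swap (p : bqf * bqf) : bqf * bqf := (p.2, p.1).

Definition pair_act (g h : Gammae) (p : bqf * bqf) : bqf * bqf :=
  (bqf_act g p.1, bqf_act h p.2).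

(** Orbits of pairs of forms are the middle term of the comparison: equivalences
    of the two forms are generators here, so that both passing to classes and
    taking Lambda are maps out of the same set. *)
Definition pair_gens : set (bqf * bqf -> bqf * bqf) :=
  [set F | [\/ F = pair_swap, F = pair_map bqf_opp
    | exists g h, [/\ g \in unitmx, h \in unitmx & F = pair_act g h]]].

Notation pair_orbit := (same_orbit form_pairs pair_gens).

Lemma pair_orbit_swap p : form_pairs p -> pair_orbit p (pair_swap p).
Proof.
move=> fp; apply: rst_step; split=> //; last by exists pair_swap => //; constructor 1.
by apply: form_pairs_swap; case: (p) fp.
Qed.

Lemma pair_orbit_opp p : form_pairs p -> pair_orbit p (pair_map bqf_opp p).
Proof.
move=> fp; apply: rst_step; split=> //; first exact: form_pairs_opp.
by exists (pair_map bqf_opp) => //; constructor 2.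
Qed.

Lemma pair_orbit_act g h p : g \in unitmx -> h \in unitmx -> form_pairs p ->
  pair_orbit p (pair_act g h p).
Proof.
move=> ug uh fp; apply: rst_step; split=> //.
  by apply: form_pairs_act => //; case: (p) fp.
by exists (pair_act g h) => //; constructor 3; exists g, h.
Qed.

Lemma pair_orbit_invariants p q : pair_orbit p q ->
  pair_disc p = pair_disc q /\ (pair_primitive p <-> pair_primitive q).
Proof.
elim=> {p q} [p q [[D0 eD _] _ [F GF ->]]|p|p q _ [-> ->]|p q r _ [-> ->] _ [-> ->]] //.
rewrite /pair_disc /pair_primitive /=.
have prim_eq P Q : (forall m, bqf_dvd m P = bqf_dvd m Q) -> bqf_primitive P <-> bqf_primitive Q.
  by move=> PQ; rewrite !bqf_primitiveP; split=> H m; move/(_ m): H; rewrite PQ.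
case: GF => [||[g [h [ug uh]]]] -> /=.
- by rewrite eD; split=> //; split=> -[].
- rewrite bqf_disc_opp; split=> //.
  by rewrite (prim_eq (bqf_opp p.1) p.1) ?(prim_eq (bqf_opp p.2) p.2) // => m; rewrite bqf_dvd_opp.
- rewrite bqf_disc_act; split; first by case/unitmx_det: ug => ->; ring.
  by rewrite (prim_eq (bqf_act g p.1) p.1) ?(prim_eq (bqf_act h p.2) p.2) // => m; rewrite bqf_dvd_act.
Qed.

Lemma bqf_class_act g P : g \in unitmx -> bqf_class (bqf_act g P) = bqf_class P.
Proof.
move=> ug; apply/seteqP; split=> Q /bqf_equivP[h uh ->]; apply/bqf_equivP.
  by exists (g *m h); rewrite ?unitmx_mul ?ug // bqf_actM.
by exists (invmx g *m h); rewrite ?unitmx_mul ?unitmx_inv ?ug // bqf_actM bqf_actK.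
Qed.

Lemma bqf_class_opp P : bqf_opp @` bqf_class P = bqf_class (bqf_opp P).
Proof.
apply/seteqP; split=> Q.
  by case=> _ /bqf_equivP[g ug ->] <-; apply/bqf_equivP; exists g; rewrite // bqf_act_opp.
case/bqf_equivP=> g ug ->; exists (bqf_act g P); last by rewrite bqf_act_opp.
by apply/bqf_equivP; exists g.
Qed.

Lemma bqf_class_refl P : bqf_class P P.
Proof. by apply/bqf_equivP; exists 1%:M; rewrite ?unitmx1 ?bqf_act1. Qed.

Lemma pair_class_opp p : pair_class (pair_map bqf_opp p) = class_opp (pair_class p).
Proof. by rewrite /class_opp /= !bqf_class_opp. Qed.

Lemma pair_class_eq p q : form_pairs p -> pair_class p = pair_class q -> pair_orbit p q.
Proof.
move=> fp [e1 e2].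
have /bqf_equivP[g ug eg] : bqf_class p.1 q.1 by rewrite e1; exact: bqf_class_refl.
have /bqf_equivP[h uh eh] : bqf_class p.2 q.2 by rewrite e2; exact: bqf_class_refl.
have -> : q = pair_act g h p by rewrite /pair_act -eg -eh; case: (q).
exact: pair_orbit_act.
Qed.

Lemma class_orbitP p q : form_pairs p -> form_pairs q ->
  same_orbit class_pairs class_gens (pair_class p) (pair_class q) <-> pair_orbit p q.
Proof.
move=> fp fq; split.
  apply: same_orbit_lift fp fq => {p q}.
  - by move=> p fp; exists p.
  - by move=> x [p fp <-]; exists p.
  - by move=> p q fp _; apply: pair_class_eq.
  move=> p q g fp fq [] -> e.
    apply: rst_trans (pair_orbit_swap fp) _.
    by apply: pair_class_eq; [apply: form_pairs_swap; case: (p) fp | rewrite e].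
  apply: rst_trans (pair_orbit_opp fp) _.
  by apply: pair_class_eq; [apply: form_pairs_opp | rewrite e pair_class_opp].
apply: same_orbit_map => {p q fp fq} p F fp fF [||[g [h [ug uh]]]] eF; rewrite eF in fF *.
- apply: rst_step; split; [by exists p|by exists (pair_swap p)|].
  by exists class_swap => //; left.
- apply: rst_step; split; [by exists p|by exists (pair_map bqf_opp p)|].
  by exists class_opp; [right | rewrite pair_class_opp].
- by rewrite /pair_class /= !bqf_class_act //; exact: rst_refl.
Qed.

(** * Similitudes acting on the lattices of pairs *)

Lemma adj_mulmx (A B : Gammae) : \adj (A *m B) = \adj B *m \adj A.
Proof.
elim/mx2P: A => ? ? ? ?; elim/mx2P: B => ? ? ? ?.
by rewrite !mx2E; congr mx2; ring.
Qed.

Lemma adj_unitmx (g : Gammae) : g \in unitmx -> \adj g = \det g *: invmx g.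
Proof.
move=> ug; apply: (can_inj (mulKmx ug)).
by rewrite mul_mx_adj -scalemxAr mulmxV // scalemx1.
Qed.

Lemma bqf_mx_scale k P : bqf_mx (bqf_scale k P) = k *: bqf_mx P.
Proof. by rewrite !bqf_mxE mx2Z /=; congr mx2; ring. Qed.

(** The defining equation is covariant: the two adjugates on its right-hand side
    produce inverses up to the determinants of g and h, whose product is the
    multiplier of X |-> g X h. *)
Lemma Lambda_mul g h P Q X : g \in unitmx -> h \in unitmx ->
  Lambda (bqf_act (invmx g) P, bqf_scale (\det g * \det h) (bqf_act h Q))
    (g *m X *m h) <-> Lambda (P, Q) X.
Proof.
move=> ug uh; rewrite /Lambda /= bqf_mx_scale !bqf_mx_act !adj_mulmx !trmx_mul.
have gK : g^T *m (invmx g)^T = 1%:M by rewrite -trmx_mul mulVmx // trmx1.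
have -> : h^T *m (X^T *m g^T) *m ((invmx g)^T *m bqf_mx P *m invmx g) =
    h^T *m (X^T *m bqf_mx P) *m invmx g.
  by rewrite !mulmxA -(mulmxA _ g^T) gK mulmx1.
have -> : (\det g * \det h) *: (h^T *m bqf_mx Q *m h) *m (\adj h *m (\adj X *m \adj g)) =
    h^T *m (bqf_mx Q *m \adj X) *m invmx g.
  rewrite !mulmxA -scalemxAl -scalemxAl -scalemxAl -(mulmxA _ h) mul_mx_adj mul_mx_scalar.
  rewrite (adj_unitmx ug) -!scalemxAl -scalemxAr !scalerA.
  rewrite (_ : _ * _ = 1) ?scale1r //.
  by case/unitmx_det: ug => ->; case/unitmx_det: uh => ->.
split=> [e|-> //].
have uht : h^T \in unitmx by rewrite unitmx_tr.
have uig : invmx g \in unitmx by rewrite unitmx_inv.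
exact: (can_inj (mulKmx uht)) (can_inj (mulmxK uig) e).
Qed.

Lemma Lambda_pair_act g h p : g \in unitmx -> h \in unitmx ->
  [set g *m X *m h | X in Lambda p] =
  Lambda (bqf_act (invmx g) p.1, bqf_scale (\det g * \det h) (bqf_act h p.2)).
Proof.
case: p => P Q ug uh; apply/seteqP; split=> [_ [X LX <-]|Y LY].
  by apply/Lambda_mul.
have eY : Y = g *m (invmx g *m Y *m invmx h) *m h.
  by rewrite !mulmxA mulmxV // mul1mx mulmxKV.
exists (invmx g *m Y *m invmx h); last by rewrite -eY.
by move: LY; rewrite {1}eY => /(Lambda_mul _ _ _ ug uh).
Qed.

(** The pair whose lattice is the transpose of that of a given pair. *)
Definition pair_transpose : bqf * bqf -> bqf * bqf :=
  pair_act bqf_rot bqf_rot \o pair_swap.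

Lemma Lambda_pair_transpose p : trmx @` Lambda p = Lambda (pair_transpose p).
Proof.
case: p => P Q; apply/seteqP; split=> [_ [X LX <-]|Y LY].
  by apply/Lambda_trmx.
by exists Y^T; rewrite ?trmxK //; apply/Lambda_trmx; rewrite trmxK.
Qed.

Lemma pair_orbit_transpose p : form_pairs p -> pair_orbit p (pair_transpose p).
Proof.
move=> fp; apply: rst_trans (pair_orbit_swap fp) _.
apply: pair_orbit_act; rewrite ?bqf_rot_unit //.
by apply: form_pairs_swap; case: (p) fp.
Qed.

Lemma pair_orbit_form_pairs p q : pair_orbit p q -> form_pairs p -> form_pairs q.
Proof.
suff /[apply] -[H _] : pair_orbit p q -> form_pairs p <-> form_pairs q by [].
by elim=> {p q} [p q []|p|p q _ ->|p q r _ -> _ ->].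
Qed.

Lemma similitude_det (e : int) f g h : similitude e f ->
  (forall X, f X = g *m X *m h) \/ (forall X, f X = g *m X^T *m h) ->
  \det g * \det h = e.
Proof.
case=> _ gf fE; have := gf 1%:M 1%:M; rewrite !gform_diag det1.
have -> : f 1%:M = g *m h by case: fE => ->; rewrite ?trmx1 mulmx1.
rewrite det_mulmx [e * _]mulrC mulr1; exact: mulfI.
Qed.

(** A similitude of multiplier e turns the lattice of p into that of an
    equivalent pair with its second form multiplied by e. For e = -1 this sign
    is the one that passing to the orthogonal complement removes. *)
Lemma similitude_Lambda (e : int) f p : e = 1 \/ e = -1 -> similitude e f -> form_pairs p ->
  exists q, [/\ form_pairs q, pair_orbit p q &
    f @` Lambda p = Lambda (q.1, bqf_scale e q.2)].
Proof.
move=> e1 sf fp; have [g [h [ug uh fE]]] := similitude_form e1 sf.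
have egh := similitude_det sf fE.
have uig : invmx g \in unitmx by rewrite unitmx_inv.
have orb q : pair_orbit p q -> exists q0, [/\ form_pairs q0, pair_orbit p q0 &
    [set g *m X *m h | X in Lambda q] = Lambda (q0.1, bqf_scale e q0.2)].
  move=> pq; have fq := pair_orbit_form_pairs pq fp.
  have pq' : pair_orbit p (pair_act (invmx g) h q).
    exact: rst_trans pq (pair_orbit_act uig uh fq).
  exists (pair_act (invmx g) h q); split=> //; first exact: pair_orbit_form_pairs pq' fp.
  by rewrite Lambda_pair_act // egh.
case: fE => fE.
  have [q [fq pq eLq]] := orb p (rst_refl _ _ _).
  exists q; split=> //; rewrite -eLq; congr (_ @` _).
  by apply/funext => X; exact: fE.
have [q [fq pq eLq]] := orb _ (pair_orbit_transpose fp).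
exists q; split=> //; rewrite -eLq -Lambda_pair_transpose image_comp.
congr (_ @` _); apply/funext => X; exact: fE.
Qed.

Lemma additive_inv (f : {additive Gammae -> Gammae}) : bijective f ->
  exists f' : {additive Gammae -> Gammae}, cancel f f' /\ cancel f' f.
Proof.
case=> f' fK f'K.
pose F := GRing.isZmodMorphism.Build _ _ f' (can2_zmod_morphism fK f'K).
pose f'' : {additive Gammae -> Gammae} := HB.pack f' F.
by exists f''.
Qed.

Definition mul2 (g h : Gammae) : {additive Gammae -> Gammae} :=
  (mulmxr h \o mulmx g : {additive Gammae -> Gammae}).

Lemma mul2_similitude g h : g \in unitmx -> h \in unitmx ->
  similitude (\det g * \det h) (mul2 g h).
Proof.
move=> ug uh; split; last by move=> X Y; exact: gform_mul.
exists (fun X => invmx g *m X *m invmx h) => X /=.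
  by rewrite !mulmxA mulVmx // mul1mx mulmxK.
by rewrite !mulmxA mulmxV // mul1mx mulmxKV.
Qed.

Lemma trmx_isometry : is_isometry (@trmx int 2 2 : {additive Gammae -> Gammae}).
Proof.
split; first by exists trmx; exact: trmxK.
by move=> X Y; rewrite /gform -raddfD !det_tr.
Qed.

(** * Orbits of lattices *)

Notation lattice_orbit xi := (same_orbit rank2_lattices (lattice_gens xi)).

Lemma isometry_orbit (xi : {additive Gammae -> Gammae}) f p q :
  is_isometry f -> form_pairs p -> form_pairs q ->
  f @` Lambda p = Lambda q -> lattice_orbit xi (Lambda p) (Lambda q).
Proof.
move=> isof fp fq fpq; apply: rst_step; split; [exact: Lambda_rank2..|].
by exists (isometry_act f); [left; exists f | rewrite -fpq].
Qed.

(** Such an f is xi composed with an isometry k, so that xi sends the lattice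
    k (Lambda p) to the orthogonal complement of f (Lambda p). *)
Lemma anti_isometry_orbit (xi : {additive Gammae -> Gammae}) f p q :
  is_anti_isometry xi -> similitude (-1) f -> form_pairs p -> form_pairs q ->
  f @` Lambda p = Lambda (q.1, bqf_opp q.2) -> lattice_orbit xi (Lambda p) (Lambda q).
Proof.
move=> hxi [[f' fK f'K] gf] fp fq fpq.
have [xibij gxi] := anti_isometry_similitude hxi.
have [xi' [xiK xi'K]] := additive_inv xibij.
pose k : {additive Gammae -> Gammae} := xi' \o f.
have xik X : xi (k X) = f X by exact: xi'K.
have isok : is_isometry k.
  split.
    by exists (f' \o xi) => X /=; rewrite /k /= ?xi'K ?fK ?f'K ?xiK.
  move=> X Y; apply: oppr_inj; rewrite -mulN1r -gxi !xik gf; exact: mulN1r.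
have [r [fr pr]] := similitude_Lambda (or_introl (erefl _)) (iffLR (isometryP k) isok) fp.
rewrite bqf_scale1 -surjective_pairing => kr.
apply: rst_trans (isometry_orbit _ isok fp fr kr) _.
apply: rst_step; split; [exact: Lambda_rank2..|].
exists (anti_act xi); first by right.
rewrite /anti_act -kr image_comp.
have -> : [set (xi \o k) x | x in Lambda p] = [set f x | x in Lambda p].
  by congr (_ @` _); apply/funext => X; exact: xik.
rewrite fpq perp_Lambda ?bqf_oppK; first by case: (q).
by apply: form_pairs_opp2; case: (q) fq.
Qed.

(** Pairs (g, h) with determinants of product 1 act through isometries; those
    with product -1 act through anti-isometries, and this is where xi is
    needed to identify pairs of GL(2, Z)-classes. *)
Lemma act_orbit (xi : {additive Gammae -> Gammae}) g h p : is_anti_isometry xi ->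
  g \in unitmx -> h \in unitmx -> form_pairs p ->
  lattice_orbit xi (Lambda p) (Lambda (pair_act g h p)).
Proof.
move=> hxi ug uh fp; have uig : invmx g \in unitmx by rewrite unitmx_inv.
have fq : form_pairs (pair_act g h p) by apply: form_pairs_act => //; case: (p) fp.
have sf := mul2_similitude uig uh.
have := Lambda_pair_act p uig uh; rewrite invmxK => img.
have [e1|e1] : \det (invmx g) * \det h = 1 \/ \det (invmx g) * \det h = -1.
- by case/unitmx_det: uig => ->; case/unitmx_det: uh => ->; [left|right|right|left].
- apply: (@isometry_orbit _ (mul2 (invmx g) h)) => //; first by apply/isometryP; rewrite -e1.
  by rewrite [LHS]img e1 bqf_scale1.
apply: (@anti_isometry_orbit _ (mul2 (invmx g) h)) => //; first by rewrite -e1.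
by rewrite [LHS]img e1 bqf_scaleN1.
Qed.

Lemma Lambda_opp p : Lambda (pair_map bqf_opp p) = Lambda p.
Proof.
have oppE P : bqf_mx (bqf_opp P) = - bqf_mx P by rewrite -bqf_scaleN1 bqf_mx_scale scaleN1r.
apply/seteqP; split=> X; rewrite /Lambda /= !oppE mulmxN mulNmx; first by move/oppr_inj.
by move=> ->.
Qed.

Lemma swap_orbit (xi : {additive Gammae -> Gammae}) p : is_anti_isometry xi ->
  form_pairs p -> lattice_orbit xi (Lambda p) (Lambda (pair_swap p)).
Proof.
move=> hxi fp; have fs : form_pairs (pair_swap p) by apply: form_pairs_swap; case: (p) fp.
have ft := pair_orbit_form_pairs (pair_orbit_transpose fp) fp.
apply: rst_trans (isometry_orbit _ trmx_isometry fp ft (Lambda_pair_transpose p)) _.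
by apply: rst_sym; apply: act_orbit; rewrite ?bqf_rot_unit.
Qed.

(** Equality of lattices only costs a common sign, by [Lambda_inj], and the image
    of a lattice under a generator is known from [similitude_Lambda]. *)
Lemma lattice_orbitP (xi : {additive Gammae -> Gammae}) p q : is_anti_isometry xi ->
  form_pairs p -> form_pairs q ->
  lattice_orbit xi (Lambda p) (Lambda q) <-> pair_orbit p q.
Proof.
move=> hxi.
have fib p' q' : form_pairs p' -> form_pairs q' -> Lambda p' = Lambda q' ->
    pair_orbit p' q'.
  move=> fp fq /(Lambda_inj fp fq)[] ->; first exact: rst_refl.
  exact: pair_orbit_opp.
move=> fp fq; split; last first.
  apply: same_orbit_map => {p q fp fq} p F fp fF [||[g [h [ug uh]]]] eF; rewrite eF.
  - exact: swap_orbit.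
  - by rewrite Lambda_opp; exact: rst_refl.
  - exact: act_orbit.
apply: same_orbit_lift fp fq => // {p q}; first exact: Lambda_rank2.
  exact: rank2_lattice_Lambda.
move=> p q g fp fq [[f isof <-]|->] eLq.
  have [r [fr pr]] := similitude_Lambda (or_introl (erefl _)) (iffLR (isometryP f) isof) fp.
  rewrite bqf_scale1 -surjective_pairing => fr'.
  by apply: rst_trans pr (fib _ _ fr fq _); rewrite eLq -fr'.
have [r [fr pr]] := similitude_Lambda (or_intror (erefl _)) (anti_isometry_similitude hxi) fp.
rewrite bqf_scaleN1 => fr'.
apply: rst_trans pr (fib _ _ fr fq _); rewrite eLq /anti_act fr' perp_Lambda.
  by rewrite bqf_oppK; case: (r).
by apply: form_pairs_opp2; case: (r) fr.
Qed.

(** * The bijection *)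

Lemma group_orbit_eq (T : Type) (S : set T) G x y :
  same_orbit S G x y -> group_orbit S G x = group_orbit S G y.
Proof.
move=> xy; apply/seteqP; split=> z; first exact/rst_trans/rst_sym.
exact: rst_trans xy.
Qed.

Unset Implicit Arguments.

Theorem theorem6p6 (xi : {additive Gammae -> Gammae}) (hxi : is_anti_isometry xi) :
  (forall p, form_pairs p -> rank2_lattices (Lambda p)) /\
  exists Lbar : set (set bqf * set bqf) -> set (set Gammae),
    [/\ forall p, form_pairs p ->
          Lbar (group_orbit class_pairs class_gens (pair_class p)) =
          group_orbit rank2_lattices (lattice_gens xi) (Lambda p),
        set_bij (group_orbits class_pairs class_gens)
          (group_orbits rank2_lattices (lattice_gens xi)) Lbar
      & forall p M, form_pairs p ->
          Lbar (group_orbit class_pairs class_gens (pair_class p)) M ->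
          has_lattice_disc M (pair_disc p) /\
          (pair_primitive p <-> lattice_primitive M)].
Proof.
split; first exact: Lambda_rank2.
pose corb := group_orbit class_pairs class_gens.
pose lorb := group_orbit rank2_lattices (lattice_gens xi).
(* The image of an orbit is the union of the orbits of its lattices; that they
   all coincide is [LbarE]. *)
pose Lbar (O : set (set bqf * set bqf)) : set (set Gammae) :=
  [set M | exists2 p, form_pairs p & O (pair_class p) /\ lorb (Lambda p) M].
have LbarE p : form_pairs p -> Lbar (corb (pair_class p)) = lorb (Lambda p).
  move=> fp; apply/seteqP; split=> M; last first.
    by move=> LM; exists p => //; split=> //; exact: rst_refl.
  case=> q fq [/(class_orbitP fp fq)/(lattice_orbitP hxi fp fq) pq qM].
  exact: rst_trans pq qM.
exists Lbar; split=> //; last first.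
  move=> p M fp; rewrite LbarE // => pM.
  have [q fq eM] : exists2 q, form_pairs q & Lambda q = M.
    apply: rank2_lattice_Lambda.
    suff: rank2_lattices (Lambda p) <-> rank2_lattices M.
      by move/iffLR; apply; exact: Lambda_rank2.
    by elim: pM => [? ? []|?|? ? _ ->|? ? ? _ -> _ ->].
  rewrite -eM in pM *.
  have /pair_orbit_invariants[-> ->] := iffLR (lattice_orbitP hxi fp fq) pM.
  by split; [exact: Lambda_disc | exact: Lambda_primitive].
split.
- by move=> _ [_ [p fp <-] <-]; rewrite LbarE //; exists (Lambda p) => //; exact: Lambda_rank2.
- move=> O O' /set_mem[_ [p fp <-] <-] /set_mem[_ [q fq <-] <-].
  rewrite !LbarE // => eL; apply/group_orbit_eq/(class_orbitP fp fq)/(lattice_orbitP hxi fp fq).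
  have : lorb (Lambda q) (Lambda q) by exact: rst_refl.
  by rewrite -eL.
- move=> _ [M /rank2_lattice_Lambda[p fp <-] <-].
  by exists (corb (pair_class p)); [exists (pair_class p) => //; exists p | rewrite LbarE].
Qed.
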